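(* Let $f\colon \mathbb L(V)\to \mathfrak g$ be a map of simply connected dg Lie algebras, where $\mathbb L(V)$ is quasi-free. Then there exist a quasi-free dg Lie algebra $\mathbb L(V\oplus W)$ and a quasi-isomorphism of dg Lie algebras $q\colon \mathbb L(V\oplus W)\xrightarrow{\sim}\mathfrak g$ (a minimal relative model for $f$) such that: (a) $\mathbb L(V)$ is a dg Lie subalgebra of $\mathbb L(V\oplus W)$ and $f=q\circ\iota$, where $\iota\colon \mathbb L(V)\to\mathbb L(V\oplus W)$ is the inclusion; (b) every quasi-isomorphism $\mathbb L(V\oplus W)\to\mathbb L(V\oplus W)$ of dg Lie algebras which restricts to an automorphism of $\mathbb L(V)$ is an automorphism.
   Context: All dg Lie algebras are over $\mathbb Q$ and homologically graded (differential of degree $-1$). For a graded vector space $V$, $\mathbb L(V)$ denotes a quasi-free dg Lie algebra generated by $V$: a dg Lie algebra $(\mathbb L(V),d)$ whose underlying graded Lie algebra is the free graded Lie algebra on $V$ (the differential is suppressed from the notation). A dg Lie algebra $\mathfrak g$ is simply connected if it is concentrated in positive degrees, $\mathfrak g=\mathfrak g_{\ge 1}$. *)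

(* Defs.v *)
From HB Require Import structures.
From mathcomp Require Import all_boot all_order all_algebra.
From mathcomp Require Import boolp.

Set Implicit Arguments.
Unset Strict Implicit.
Unset Printing Implicit Defensive.

Import GRing.Theory.
Local Open Scope ring_scope.
Local Open Scope quotient_scope.

(* A Z-graded rational vector space is the family of its homogeneous parts.
   Operations that change the degree take the target degree as an argument,
   together with an equation relating it to the source degrees, so that no
   transport along equalities of degrees is needed; such equations are unique
   since int has decidable equality. *)
Record gspace := GSpace { gpart :> int -> lmodType rat }.

Definition ghom (V W : gspace) := forall n : int, {linear V n -> W n}.

Definition gsum (V W : gspace) : gspace :=
  GSpace (fun n => (V n * W n)%type : lmodType rat).

Record glie := GLie {
  glie_space :> gspace;
  br : forall i j k : int, i + j = k ->
       glie_space i -> glie_space j -> glie_space k;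
  br_linearl : forall i j k (e : i + j = k) (a : rat) x x' y,
    br e (a *: x + x') y = a *: br e x y + br e x' y;
  br_linearr : forall i j k (e : i + j = k) (a : rat) x y y',
    br e x (a *: y + y') = a *: br e x y + br e x y';
  br_antisym : forall i j k (e : i + j = k) (e' : j + i = k) x y,
    br e x y = - ((-1) ^ (i * j) *: br e' y x);
  br_jacobi : forall i j k ij jk ik n
    (eij : i + j = ij) (ejk : j + k = jk) (eik : i + k = ik)
    (e1 : i + jk = n) (e2 : ij + k = n) (e3 : j + ik = n) x y z,
    br e1 x (br ejk y z) =
      br e2 (br eij x y) z + (-1) ^ (i * j) *: br e3 y (br eik x z)
}.

Record glie_hom (L M : glie) := GLieHom {
  glie_map :> forall n : int, {linear L n -> M n};
  glie_map_br : forall i j k (e : i + j = k) x y,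
    glie_map k (br e x y) = br e (glie_map i x) (glie_map j y)
}.

Record dglie := DGLie {
  dglie_lie :> glie;
  dif : forall i j : int, j + 1 = i -> {linear dglie_lie i -> dglie_lie j};
  dif_dif : forall i j k (e : j + 1 = i) (e' : k + 1 = j) x,
    dif e' (dif e x) = 0;
  dif_br : forall i j k i' j' k' (e : i + j = k)
    (ei : i' + 1 = i) (ej : j' + 1 = j) (ek : k' + 1 = k)
    (e1 : i' + j = k') (e2 : i + j' = k') x y,
    dif ek (br e x y) = br e1 (dif ei x) y + (-1) ^ i *: br e2 x (dif ej y)
}.
Arguments dif {_ _ _} _.

Record dglie_hom (L M : dglie) := DGLieHom {
  dglie_map :> glie_hom L M;
  dglie_map_dif : forall i j (e : j + 1 = i) x,
    dglie_map j (dif e x) = dif e (dglie_map i x)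
}.

Definition simply_connected (L : dglie) : Prop :=
  forall n : int, n < 1 -> forall x : L n, x = 0.

Definition dglie_automorphism (L : dglie) (phi : dglie_hom L L) : Prop :=
  exists psi : dglie_hom L L, forall n : int,
    cancel (phi n) (psi n) /\ cancel (psi n) (phi n).

(* The universal property of the free graded Lie algebra on V. *)
Definition free_glie_on (V : gspace) (L : glie) (eta : ghom V L) : Prop :=
  forall (K : glie) (h : ghom V K),
    exists2 F : glie_hom L K,
      (forall n (v : V n), F n (eta n v) = h n v) &
      (forall F' : glie_hom L K,
         (forall n (v : V n), F' n (eta n v) = h n v) ->
         forall n (x : L n), F' n x = F n x).

(* A term of type quasi_free V is a dg Lie algebra (L(V), d). *)
Record quasi_free (V : gspace) := QuasiFree {
  qf_dglie :> dglie;
  qf_gen : ghom V qf_dglie;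
  qf_free : free_glie_on qf_gen
}.

Section Homology.
Variables (L : dglie) (n : int).

Definition is_cycle : pred (L n) := fun x => dif (subrK 1 n) x == 0.

Fact is_cycle_zmod_closed : zmod_closed is_cycle.
Proof.
split=> [|x y]; rewrite /is_cycle !unfold_in ?linear0 //.
by move=> /eqP dx /eqP dy; rewrite linearB /= dx dy subr0.
Qed.
HB.instance Definition _ :=
  GRing.isZmodClosed.Build (L n) is_cycle is_cycle_zmod_closed.

Definition cycle := {x : L n | is_cycle x}.
HB.instance Definition _ := SubType.on cycle.
HB.instance Definition _ := Choice.on cycle.
HB.instance Definition _ := [SubChoice_isSubZmodule of cycle by <:].

Definition is_boundary : pred cycle :=
  fun z => `[< exists y : L (n + 1), dif erefl y = val z >].

Fact is_boundary_zmod_closed : zmod_closed is_boundary.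
Proof.
split=> [|x y]; rewrite !unfold_in.
  by apply/asboolP; exists 0; rewrite linear0.
move=> /asboolP[u du] /asboolP[v dv]; apply/asboolP; exists (u - v).
by rewrite linearB /= du dv.
Qed.
HB.instance Definition _ :=
  GRing.isZmodClosed.Build cycle is_boundary is_boundary_zmod_closed.

Definition boundaries : zmodClosed cycle :=
  GRing.ZmodClosed.clone _ is_boundary _.

(* Only the additive group structure of the quotient is recorded; it determines
   the rational vector space structure. *)
Definition homology : zmodType := {ideal_quot boundaries}.

Lemma homology_eqP (z z' : cycle) :
  \pi_homology z = \pi_homology z' <->
  exists y : L (n + 1), dif erefl y = val z - val z'.
Proof.
have -> : val z - val z' = val (z - z') by [].
have E : (z - z' \in boundaries) = (\pi_homology z == \pi_homology z').
  exact: (Quotient.idealrBE boundaries z z').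
split=> [/eqP|H]; first by rewrite -E unfold_in => /asboolP.
by apply/eqP; rewrite -E unfold_in; apply/asboolP.
Qed.

End Homology.

Section HomologyMap.
Variables (L M : dglie) (f : dglie_hom L M) (n : int).

Fact cycle_map_subproof (z : cycle L n) : is_cycle (f n (val z)).
Proof.
by rewrite /is_cycle -dglie_map_dif (eqP (valP z)) linear0.
Qed.

Definition cycle_map (z : cycle L n) : cycle M n :=
  Sub (f n (val z)) (cycle_map_subproof z).

Definition homology_map (c : homology L n) : homology M n :=
  \pi_(homology M n) (cycle_map (repr c)).

Lemma homology_map_pi (z : cycle L n) :
  homology_map (\pi_(homology L n) z) = \pi_(homology M n) (cycle_map z).
Proof.
have [y dy] := (homology_eqP (repr (\pi_(homology L n) z)) z).1 (reprK _).
apply/(homology_eqP (cycle_map _)); exists (f _ y).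
by rewrite -dglie_map_dif dy linearB.
Qed.

End HomologyMap.

Definition quasi_iso (L M : dglie) (f : dglie_hom L M) : Prop :=
  forall n : int, bijective (@homology_map L M f n).

(* Main.v *)
From HB Require Import structures.
Require Import Defs.
From mathcomp Require Import all_boot all_order all_algebra.
From mathcomp Require Import boolp classical_sets zify.

(* Write L(n) for the subalgebra generated by LV and the new generators of
   degree at most n. The generators W_k of degree k = n + 1 are chosen to
   represent the relative homology of L(n) -> g in degree k, so that they kill
   it; in the limit q is a quasi-isomorphism. Representing homology faithfully
   makes the differential map degree n + 2 into L(n), and this minimality alone
   forces (b): by induction on n, a quasi-isomorphism phi that restricts to an
   automorphism of LV is bijective on L(n), since modulo L(n) there are no
   boundaries in degree n + 1.

   To avoid building a colimit of dg Lie algebras, everything happens inside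
   one graded Lie algebra M, obtained from LV by freely adjoining linear maps
   sigma : M_(k-1) x g_k -> M_k. It carries a derivation D with
   D (sigma (x, y)) = x and a morphism q to g with q (sigma (x, y)) = y. The
   recursive choice of W_k is then that of a subspace of M_(k-1) x g_k, and
   D squares to zero on the subalgebra generated by LV and these choices. *)

Set Implicit Arguments.
Unset Strict Implicit.
Unset Printing Implicit Defensive.

Import Order.TTheory GRing.Theory Num.Theory.
Local Open Scope ring_scope.
Local Open Scope quotient_scope.

(** * Subspaces *)

Section LinearAlgebra.
Variable F : fieldType.
Implicit Types E G : lmodType F.

Definition mklin E G (f : E -> G) (lin_f : linear f) : {linear E -> G} :=
  HB.pack f (GRing.isLinear.Build F E G *:%R f lin_f).

Record subspace E := Subspace {
  smem :> E -> Prop;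
  smem0 : smem 0;
  smemP : forall a x y, smem x -> smem y -> smem (a *: x + y)
}.

Lemma smemD E (S : subspace E) x y : S x -> S y -> S (x + y).
Proof. by move=> Sx Sy; rewrite -[x]scale1r; apply: smemP. Qed.

Lemma smemZ E (S : subspace E) a x : S x -> S (a *: x).
Proof.
by move=> Sx; rewrite -[_ *: _]addr0; apply: smemP => //; apply: smem0.
Qed.

Lemma smemN E (S : subspace E) x : S x -> S (- x).
Proof. by rewrite -scaleN1r; apply: smemZ. Qed.

Lemma smemB E (S : subspace E) x y : S x -> S y -> S (x - y).
Proof. by move=> Sx Sy; apply: smemD => //; apply: smemN. Qed.

(** Classical reflection to a boolean predicate lets a subspace cut out by a logical formula become
    an [lmodType] through the subtype construction. *)
Definition smemb E (S : subspace E) : pred E := fun x => `[< S x >].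

Fact smemb_submod_closed E (S : subspace E) : submod_closed (smemb S).
Proof.
split; first by apply/asboolP/smem0.
by move=> a x y /asboolP Sx /asboolP Sy; apply/asboolP/smemP.
Qed.
HB.instance Definition _ E (S : subspace E) :=
  GRing.isSubmodClosed.Build F E (smemb S) (smemb_submod_closed S).

Definition subsp E (S : subspace E) := {x : E | smemb S x}.
HB.instance Definition _ E (S : subspace E) := SubType.on (subsp S).
HB.instance Definition _ E (S : subspace E) := Choice.on (subsp S).
HB.instance Definition _ E (S : subspace E) :=
  [SubChoice_isSubLmodule of subsp S by <:].

Definition insp E (S : subspace E) x (Sx : S x) : subsp S :=
  exist _ x (introT (asboolP _) Sx).

Lemma subspP E (S : subspace E) (x : subsp S) : S (val x).
Proof. exact/asboolP/(valP x). Qed.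

Lemma subsp_val_linear E (S : subspace E) : linear (val : subsp S -> E).
Proof. by []. Qed.

Definition subsp_incl E (S : subspace E) : {linear subsp S -> E} :=
  mklin (@subsp_val_linear E S).

Definition trivial_subspace E : subspace E.
Proof.
by exists (fun x => x = 0) => // a x y -> ->; rewrite scaler0 addr0.
Defined.

Definition full_subspace E : subspace E.
Proof. by exists (fun=> True). Defined.

Definition kernel E G (f : {linear E -> G}) : subspace E.
Proof.
exists (fun x => f x = 0) => [|a x y fx fy]; first exact: linear0.
by rewrite linearP fx fy scaler0 addr0.
Defined.

Definition limage E G (f : {linear E -> G}) : subspace G.
Proof.
exists (fun y => exists x, y = f x); first by exists 0; rewrite linear0.
by move=> a _ _ [x ->] [y ->]; exists (a *: x + y); rewrite linearP.
Defined.

(** Zorn's lemma gives a maximal subset [A] of [Z] that is closed under linear combinations and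
    meets [B] at most in zero. If some [z] in [Z] were outside [A + B], adding its span to [A] would
    contradict maximality. *)
Lemma complement_subproof E (Z B : subspace E) : exists C : subspace E,
  [/\ forall x, C x -> Z x, forall x, C x -> B x -> x = 0 &
      forall z, Z z -> exists2 c, C c & B (z - c)].
Proof.
pose ok (X : set E) := [/\ forall a x y, X x -> X y -> X (a *: x + y),
  forall x, X x -> Z x & forall x, X x -> B x -> x = 0].
have [|A [[Alin AZ AB] Amax]] := @Zorn_bigcup E ok.
  move=> ch chok tot; split.
  - move=> a x y [X1 ch1 Xx] [X2 ch2 Xy].
    case: (tot _ _ ch1 ch2) => sX.
      exists X2 => //; have [+ _ _] := chok _ ch2.
      by apply=> //; apply: sX.
    exists X1 => //; have [+ _ _] := chok _ ch1.
    by apply=> //; apply: sX.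
  - by move=> x [X chX Xx]; have [_ + _] := chok _ chX; apply.
  - by move=> x [X chX Xx]; have [_ _] := chok _ chX; apply.
(* The condition [ok] does not ask for 0, since the union of the empty chain is empty. Maximality
   rules the empty set out. *)
have A0 : A 0.
  apply: contrapT => nA0.
  have nA x : ~ A x.
    by move=> Ax; have := Alin (-1) x x Ax Ax; rewrite scaleN1r addNr.
  apply: (Amax (fun x => A x \/ x = 0)).
    split=> [x Ax|sub]; first by left.
    by apply: nA0; apply: sub; right.
  split.
  - by move=> a x y [/nA//|->] [/nA//|->]; right; rewrite scaler0 addr0.
  - by move=> x [/AZ//|->]; apply: smem0.
  - by move=> x [/AB//|->].
exists (Subspace A0 Alin); split=> //= z Zz.
apply: contrapT => nz.
(* If [a] were nonzero, dividing by it would exhibit [z] modulo [B] as the element [- (a^-1 *: x)]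
   of [A]. *)
have AZadd x a : A x -> B (x + a *: z) -> a = 0.
  move=> Ax Bx; apply/eqP/negPn/negP => a0; apply: nz.
  exists (- (a^-1 *: x)).
    by rewrite -scalerN -[_ *: _]addr0 -scaleN1r; apply: (Alin) => //;
      rewrite -[_ *: _]addr0; apply: Alin.
  by rewrite opprK addrC -[z]scale1r -(mulVf a0) -scalerA -scalerDr;
    apply: smemZ.
apply: (Amax (fun u => exists x a, A x /\ u = x + a *: z)).
  split=> [x Ax|sub]; first by exists x, 0; rewrite scale0r addr0.
  apply: nz; exists z; last by rewrite subrr; apply: smem0.
  by apply: sub; exists 0, 1; rewrite scale1r add0r.
split.
- move=> a _ _ [x [b [Ax ->]]] [y [c [Ay ->]]].
  exists (a *: x + y), (a * b + c); split; first exact: Alin.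
  by rewrite scalerDr scalerDl scalerA addrACA.
- by move=> _ [x [a [/AZ Zx ->]]]; apply: smemD => //; apply: smemZ.
- move=> _ [x [a [Ax ->]]] Bx; have a0 := AZadd _ _ Ax Bx.
  by move: Bx; rewrite a0 scale0r addr0 => /AB ->.
Qed.

Definition complement E (Z B : subspace E) : subspace E :=
  projT1 (cid (complement_subproof Z B)).

Lemma complementP E (Z B : subspace E) :
  [/\ forall x, complement Z B x -> Z x,
      forall x, complement Z B x -> B x -> x = 0 &
      forall z, Z z -> exists2 c, complement Z B c & B (z - c)].
Proof. exact: projT2 (cid (complement_subproof Z B)). Qed.

(** A linear relation that is total and single-valued is the graph of a linear map. This yields maps
    defined through complements, without bases. *)
Lemma linear_of_rel E G (R : E -> G -> Prop) :
    (forall a x y u v, R x u -> R y v -> R (a *: x + y) (a *: u + v)) ->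
    (forall x, exists u, R x u) -> (forall x u v, R x u -> R x v -> u = v) ->
  exists f : {linear E -> G}, forall x, R x (f x).
Proof.
move=> Rlin Rtot Rfun; pose f x := projT1 (cid (Rtot x)).
have fP x : R x (f x) := projT2 (cid (Rtot x)).
have flin : linear f by move=> a x y; apply: (Rfun (a *: x + y)) => //;
  apply: Rlin.
by exists (mklin flin).
Qed.

(** The projection onto [S] along a complement of [S]. *)
Lemma linear_retraction E (S : subspace E) :
  exists r : {linear E -> subsp S}, forall x, r (val x) = x.
Proof.
have [_ CS Cdec] := complementP (full_subspace E) S.
set C := complement _ _ in CS Cdec.
have [|||r rP] := @linear_of_rel E (subsp S) (fun x u => C (x - val u)).
- move=> a x y u v Cx Cy.
  have -> : a *: x + y - val (a *: u + v) = a *: (x - val u) + (y - val v).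
    by rewrite subsp_val_linear scalerBr opprD addrACA.
  exact: smemP.
- by move=> x; have [//|c Cc Sc] := Cdec x; exists (insp Sc);
  rewrite opprB addrCA subrr addr0.
- move=> x u v Cu Cv; apply/val_inj/eqP; rewrite -subr_eq0; apply/eqP/CS.
    have -> : val u - val v = (x - val v) - (x - val u).
      by rewrite opprB [RHS]addrC subrKA.
    exact: smemB.
  by apply: smemB; apply: subspP.
exists r => x; apply/val_inj/eqP; rewrite eq_sym -subr_eq0; apply/eqP/CS => //.
by apply: smemB; apply: subspP.
Qed.

(** On a complement [C] of the kernel, [f] is injective with full image. The map [s] retracts [G]
    onto the image and then takes the preimage in [C]. *)
Lemma pseudo_inverse E G (f : {linear E -> G}) :
  exists s : {linear G -> E}, forall x, f (s (f x)) = f x.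
Proof.
have [_ Ck Cdec] := complementP (full_subspace E) (kernel f).
set C := complement _ _ in Ck Cdec.
have fC x : exists2 c, C c & f c = f x.
  have [//|c Cc /eqP] := Cdec x; rewrite linearB subr_eq0 => /eqP fc.
  by exists c.
have [r rK] := linear_retraction (limage f).
have [|||s sP] := @linear_of_rel G E (fun y x => C x /\ f x = val (r y)).
- move=> a x y u v [Cu fu] [Cv fv]; split; first exact: smemP.
  by rewrite !linearP fu fv.
- move=> y; have [x ->] := subspP (r y); have [c Cc fc] := fC x.
  by exists c.
- move=> y u v [Cu fu] [Cv fv]; apply/eqP; rewrite -subr_eq0; apply/eqP/Ck.
    exact: smemB.
  by rewrite /= linearB fu fv subrr.
exists s => x; have imx : limage f (f x) by exists x.
by have [_ ->] := sP (f x); rewrite -[f x in LHS]/(val (insp imx)) rK.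
Qed.

End LinearAlgebra.

(** * Graded Lie algebras *)

Lemma signzK (i : int) : (-1) ^ i * (-1) ^ i = 1 :> rat.
Proof. by rewrite -exprMz_comm // mulN1r opprK exp1rz. Qed.

Lemma signzB1 (i : int) : (-1) ^ (i - 1) = - (-1) ^ i :> rat.
Proof. by rewrite expfzDr // exprN1 invrN invr1 mulrN1. Qed.

Lemma signzD (i j : int) : (-1) ^ (i + j) = (-1) ^ i * (-1) ^ j :> rat.
Proof. exact: expfzDr. Qed.

Lemma signzMB1l (i j : int) :
  (-1) ^ ((i - 1) * j) = (-1) ^ (i * j) * (-1) ^ j :> rat.
Proof.
rewrite mulrBl mul1r expfzDr //; congr (_ * _).
by rewrite -[LHS]mulr1 -[X in _ * X](signzK j) mulrA -signzD addNr expr0z mul1r.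
Qed.

Lemma signzMB1r (i j : int) :
  (-1) ^ (i * (j - 1)) = (-1) ^ (i * j) * (-1) ^ i :> rat.
Proof. by rewrite mulrC signzMB1l [j * i]mulrC. Qed.

Section Bracket.
Variable M : glie.

Lemma br_irrel i j k (e e' : i + j = k) (x : M i) (y : M j) :
  br e x y = br e' x y.
Proof. by rewrite (eq_irrelevance e e'). Qed.

Section Fixed.
Variables (i j k : int) (e : i + j = k).
Implicit Types (x : M i) (y : M j).

Lemma brDl x x' y : br e (x + x') y = br e x y + br e x' y.
Proof. by rewrite -[x]scale1r br_linearl !scale1r. Qed.

Lemma brDr x y y' : br e x (y + y') = br e x y + br e x y'.
Proof. by rewrite -[y]scale1r br_linearr !scale1r. Qed.

Lemma br0l y : br e 0 y = 0 :> M k.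
Proof. by apply: (addrI (br e 0 y)); rewrite -brDl !addr0. Qed.

Lemma br0r x : br e x 0 = 0 :> M k.
Proof. by apply: (addrI (br e x 0)); rewrite -brDr !addr0. Qed.

Lemma brZl a x y : br e (a *: x) y = a *: br e x y.
Proof. by rewrite -[a *: x]addr0 br_linearl br0l !addr0. Qed.

Lemma brZr a x y : br e x (a *: y) = a *: br e x y.
Proof. by rewrite -[a *: y]addr0 br_linearr br0r !addr0. Qed.
End Fixed.

(** Derivations are indexed with target degree [k - 1], while [dif] accepts any target degree with
    an equation; this transport mediates between the two. *)
Definition gcast i j (e : i = j) (x : M i) : M j :=
  let: erefl in _ = j0 := e return M j0 in x.

Lemma gcast_linear i j (e : i = j) : linear (gcast e).
Proof. by case: _ / e. Qed.

Lemma gcast_id i (e : i = i) (x : M i) : gcast e x = x.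
Proof. by rewrite (eq_axiomK e). Qed.

Definition derivation (D : forall k, {linear M k -> M (k - 1)}) :=
  forall i j k (e : i + j = k) (e1 : i - 1 + j = k - 1)
    (e2 : i + (j - 1) = k - 1)
    x y, D k (br e x y) = br e1 (D i x) y + (-1) ^ i *: br e2 x (D j y).

End Bracket.

(* M tensored with the dual numbers Q[eps]/(eps^2), |eps| = 1: the map
   x |-> x + eps (D x) is a morphism iff D is a derivation. *)
Section Dual.
Variable M : glie.

Definition dual_space : gspace :=
  GSpace (fun k => (M k * M (k - 1))%type : lmodType rat).

Fact deg_predl (i j k : int) : i + j = k -> i - 1 + j = k - 1.
Proof. by move=> <-; rewrite addrAC. Qed.

Fact deg_predr (i j k : int) : i + j = k -> i + (j - 1) = k - 1.
Proof. by move=> <-; rewrite addrA. Qed.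

(** A pair stands for x.1 + eps x.2. The sign arises from moving eps past [x.1], and the bracket of
    the two eps-parts vanishes because eps^2 = 0. *)
Definition dual_br i j k (e : i + j = k) (x : dual_space i) (y : dual_space j) :
    dual_space k :=
  (br e x.1 y.1,
   br (deg_predl e) x.2 y.1 + (-1) ^ i *: br (deg_predr e) x.1 y.2).

Fact dual_br_linearl i j k (e : i + j = k) (a : rat) x x' y :
  dual_br e (a *: x + x') y = a *: dual_br e x y + dual_br e x' y.
Proof.
congr pair; rewrite /= ?br_linearl // !scalerDr !scalerA [a * _]mulrC -!scalerA.
by rewrite addrACA.
Qed.

Fact dual_br_linearr i j k (e : i + j = k) (a : rat) x y y' :
  dual_br e x (a *: y + y') = a *: dual_br e x y + dual_br e x y'.
Proof.
congr pair; rewrite /= ?br_linearr // !scalerDr !scalerA [a * _]mulrC -!scalerA.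
by rewrite addrACA.
Qed.

Fact dual_br_antisym i j k (e : i + j = k) (e' : j + i = k) x y :
  dual_br e x y = - ((-1) ^ (i * j) *: dual_br e' y x).
Proof.
congr pair; rewrite /=; first exact: br_antisym.
rewrite (br_antisym (deg_predl e) (deg_predr e')).
rewrite (br_antisym (deg_predr e) (deg_predl e')).
rewrite signzMB1l signzMB1r scalerN scalerA mulrCA signzK mulr1.
by rewrite scalerDr scalerA opprD [LHS]addrC.
Qed.

Fact dual_br_jacobi i j k ij jk ik n
    (eij : i + j = ij) (ejk : j + k = jk) (eik : i + k = ik)
    (e1 : i + jk = n) (e2 : ij + k = n) (e3 : j + ik = n) x y z :
  dual_br e1 x (dual_br ejk y z) = dual_br e2 (dual_br eij x y) z +
    (-1) ^ (i * j) *: dual_br e3 y (dual_br eik x z).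
Proof.
congr pair; rewrite /=; first exact: br_jacobi.
rewrite !(brDl, brDr, brZl, brZr).
(* The eps-component is the sum of three Jacobi identities in [M], with the eps-part taken from [x],
   [y] and [z] in turn. Only Koszul signs remain to be matched. *)
have E1 := br_jacobi (deg_predl eij) ejk (deg_predl eik) (deg_predl e1)
  (deg_predl e2) (deg_predr e3) x.2 y.1 z.1.
have E2 := br_jacobi (deg_predr eij) (deg_predl ejk) eik (deg_predr e1)
  (deg_predl e2) (deg_predl e3) x.1 y.2 z.1.
have E3 := br_jacobi eij (deg_predr ejk) (deg_predr eik) (deg_predr e1)
  (deg_predr e2) (deg_predr e3) x.1 y.1 z.2.
have Eij : (-1) ^ ij = (-1) ^ i * (-1) ^ j :> rat by rewrite -eij signzD.
rewrite E1 E2 E3 Eij !signzMB1l !signzMB1r !scalerDr !scalerA.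
rewrite [(-1) ^ i * (_ * (-1) ^ i)]mulrCA signzK mulr1.
rewrite [(-1) ^ i * (-1) ^ j * _]mulrC -![(-1) ^ (i * j) * _ * _]mulrA.
rewrite [(-1) ^ j * (-1) ^ i]mulrC.
rewrite -![in LHS]addrA -![in RHS]addrA; congr (_ + _).
rewrite [LHS]addrCA; congr (_ + _).
by rewrite [LHS]addrCA [RHS]addrCA; congr (_ + _); rewrite [LHS]addrCA.
Qed.

Definition dual_glie : glie :=
  GLie dual_br_linearl dual_br_linearr dual_br_antisym dual_br_jacobi.

End Dual.

(** * Freely adjoining linear maps *)

Section Extension.
Variables (A : glie) (Y : gspace).

(** Raw expressions, to be divided by the congruence below. Since [tsig] accepts any term, the
    adjoined maps can be nested, as an iterated choice of generators requires. *)
Inductive term : int -> Type :=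
| tzero k : term k
| tadd k : term k -> term k -> term k
| tscale k : rat -> term k -> term k
| tbr i j k : i + j = k -> term i -> term j -> term k
| temb k : A k -> term k
| tsig k : term (k - 1) -> Y k -> term k.

Arguments tzero {k}.

(** The least congruence imposing the axioms of a graded Lie algebra, the compatibility of [temb]
    with the structure of [A], and the joint linearity of [tsig] in its two arguments. *)
Inductive cong : forall k, term k -> term k -> Prop :=
| cong_refl k (s : term k) : cong s s
| cong_sym k (s t : term k) : cong s t -> cong t s
| cong_trans k (s t u : term k) : cong s t -> cong t u -> cong s u
| cong_add k (s s' t t' : term k) :
    cong s s' -> cong t t' -> cong (tadd s t) (tadd s' t')
| cong_scale k a (s s' : term k) : cong s s' -> cong (tscale a s) (tscale a s')
| cong_br i j k (e : i + j = k) (s s' : term i) (t t' : term j) :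
    cong s s' -> cong t t' -> cong (tbr e s t) (tbr e s' t')
| cong_sig k (s s' : term (k - 1)) (y : Y k) :
    cong s s' -> cong (tsig s y) (tsig s' y)
| cong_addA k (s t u : term k) :
    cong (tadd s (tadd t u)) (tadd (tadd s t) u)
| cong_addC k (s t : term k) : cong (tadd s t) (tadd t s)
| cong_add0 k (s : term k) : cong (tadd tzero s) s
| cong_addN k (s : term k) : cong (tadd (tscale (-1) s) s) tzero
| cong_scaleA k a b (s : term k) :
    cong (tscale a (tscale b s)) (tscale (a * b) s)
| cong_scale1 k (s : term k) : cong (tscale 1 s) s
| cong_scaleDr k a (s t : term k) :
    cong (tscale a (tadd s t)) (tadd (tscale a s) (tscale a t))
| cong_scaleDl k a b (s : term k) :
    cong (tscale (a + b) s) (tadd (tscale a s) (tscale b s))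
| cong_brl i j k (e : i + j = k) a (s s' : term i) (t : term j) :
    cong (tbr e (tadd (tscale a s) s') t)
         (tadd (tscale a (tbr e s t)) (tbr e s' t))
| cong_brr i j k (e : i + j = k) a (s : term i) (t t' : term j) :
    cong (tbr e s (tadd (tscale a t) t'))
         (tadd (tscale a (tbr e s t)) (tbr e s t'))
| cong_antisym i j k (e : i + j = k) (e' : j + i = k) (s : term i)
    (t : term j) :
    cong (tbr e s t) (tscale (-1) (tscale ((-1) ^ (i * j)) (tbr e' t s)))
| cong_jacobi i j k ij jk ik n
    (eij : i + j = ij) (ejk : j + k = jk) (eik : i + k = ik)
    (e1 : i + jk = n) (e2 : ij + k = n) (e3 : j + ik = n)
    (s : term i) (t : term j) (u : term k) :
    cong (tbr e1 s (tbr ejk t u))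
         (tadd (tbr e2 (tbr eij s t) u)
               (tscale ((-1) ^ (i * j)) (tbr e3 t (tbr eik s u))))
| cong_emb_lin k a (x y : A k) :
    cong (temb (a *: x + y)) (tadd (tscale a (temb x)) (temb y))
| cong_emb_br i j k (e : i + j = k) (x : A i) (y : A j) :
    cong (temb (br e x y)) (tbr e (temb x) (temb y))
| cong_sig_lin k a (s t : term (k - 1)) (x y : Y k) :
    cong (tsig (tadd (tscale a s) t) (a *: x + y))
         (tadd (tscale a (tsig s x)) (tsig t y)).

HB.instance Definition _ k := gen_eqMixin (term k).
HB.instance Definition _ k := gen_choiceMixin (term k).

Definition congb k : rel (term k) := fun s t => `[< cong s t >].

Fact congb_equiv k : equiv_class_of (@congb k).
Proof.
split=> [s|s t|t s u].
- exact/asboolP/cong_refl.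
- by apply/asboolP/asboolP => /cong_sym.
- by move=> /asboolP st /asboolP tu; apply/asboolP/(cong_trans st).
Qed.
Canonical congb_equiv_rel k := EquivRelPack (@congb_equiv k).

Definition term_sort k := {eq_quot @congb k}%qT.
HB.instance Definition _ k := Choice.on (term_sort k).
HB.instance Definition _ k := EqQuotient.on (term_sort k).

Definition tclass k (t : term k) : term_sort k := \pi_(term_sort k) t.

Lemma tclassP k (s t : term k) : tclass s = tclass t <-> cong s t.
Proof.
split=> [/eqP|]; first by rewrite eqquotE => /asboolP.
by move=> st; apply/eqP; rewrite eqquotE; apply/asboolP.
Qed.

Definition trepr k (x : term_sort k) : term k := repr x.

Lemma treprK k (x : term_sort k) : tclass (trepr x) = x.
Proof. exact: reprK. Qed.

Lemma trepr_cong k (t : term k) : cong (trepr (tclass t)) t.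
Proof. by apply/tclassP; rewrite treprK. Qed.

Definition term_add k (x y : term_sort k) := tclass (tadd (trepr x) (trepr y)).
Definition term_scale k a (x : term_sort k) := tclass (tscale a (trepr x)).

Lemma term_addE k (s t : term k) :
  term_add (tclass s) (tclass t) = tclass (tadd s t).
Proof. by apply/tclassP; apply: cong_add; apply: trepr_cong. Qed.

Lemma term_scaleE k a (s : term k) :
    term_scale a (tclass s) = tclass (tscale a s).
Proof. by apply/tclassP; apply: cong_scale; apply: trepr_cong. Qed.

Section Module.
Variable k : int.
Implicit Types x y z : term_sort k.

Fact term_addA x y z : term_add x (term_add y z) = term_add (term_add x y) z.
Proof.
rewrite -[x]treprK -[y]treprK -[z]treprK !term_addE.
exact/tclassP/cong_addA.
Qed.

Fact term_addC x y : term_add x y = term_add y x.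
Proof. exact/tclassP/cong_addC. Qed.

Fact term_add0 x : term_add (tclass tzero) x = x.
Proof. by rewrite -[x]treprK term_addE; apply/tclassP/cong_add0. Qed.

Fact term_addN x : term_add (term_scale (-1) x) x = tclass tzero.
Proof. by rewrite -[x]treprK term_scaleE term_addE;
  apply/tclassP/cong_addN. Qed.

HB.instance Definition _ :=
  GRing.isZmodule.Build (term_sort k) term_addA term_addC term_add0 term_addN.

Lemma tclassD (s t : term k) : tclass (tadd s t) = tclass s + tclass t.
Proof. exact/esym/term_addE. Qed.

Fact term_scaleA a b x : term_scale a (term_scale b x) = term_scale (a * b) x.
Proof. by rewrite -[x]treprK !term_scaleE; apply/tclassP/cong_scaleA. Qed.

Fact term_scale1 x : term_scale 1 x = x.
Proof. by rewrite -[x]treprK !term_scaleE; apply/tclassP/cong_scale1. Qed.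

Fact term_scaleDr : right_distributive (@term_scale k) +%R.
Proof.
move=> a x y; rewrite -[x]treprK -[y]treprK -tclassD !term_scaleE -tclassD.
by apply/tclassP/cong_scaleDr.
Qed.

Fact term_scaleDl x : {morph (@term_scale k)^~ x : a b / a + b}.
Proof.
move=> a b; rewrite -[x]treprK !term_scaleE -tclassD.
exact/tclassP/cong_scaleDl.
Qed.

HB.instance Definition _ := GRing.Zmodule_isLmodule.Build rat (term_sort k)
  term_scaleA term_scale1 term_scaleDr term_scaleDl.

Lemma tclassZ a (s : term k) : tclass (tscale a s) = a *: tclass s.
Proof. exact/esym/term_scaleE. Qed.

Lemma tclassN (s : term k) : tclass (tscale (-1) s) = - tclass s.
Proof. by rewrite tclassZ scaleN1r. Qed.

End Module.

Definition term_space : gspace := GSpace (fun k => term_sort k : lmodType rat).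

Definition term_br i j k (e : i + j = k) (x : term_space i) (y : term_space j) :
  term_space k := tclass (tbr e (trepr x) (trepr y)).

Lemma tclass_br i j k (e : i + j = k) (s : term i) (t : term j) :
  tclass (tbr e s t) = term_br e (tclass s) (tclass t).
Proof. by apply/tclassP/cong_br; apply/cong_sym/trepr_cong. Qed.

Fact term_br_linearl i j k (e : i + j = k) (a : rat) x x' y :
  term_br e (a *: x + x') y = a *: term_br e x y + term_br e x' y.
Proof.
rewrite -[x]treprK -[x']treprK -[y]treprK -tclassZ -tclassD -!tclass_br.
by rewrite -tclassZ -tclassD; apply/tclassP/cong_brl.
Qed.

Fact term_br_linearr i j k (e : i + j = k) (a : rat) x y y' :
  term_br e x (a *: y + y') = a *: term_br e x y + term_br e x y'.
Proof.
rewrite -[x]treprK -[y']treprK -[y]treprK -tclassZ -tclassD -!tclass_br.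
by rewrite -tclassZ -tclassD; apply/tclassP/cong_brr.
Qed.

Fact term_br_antisym i j k (e : i + j = k) (e' : j + i = k) x y :
  term_br e x y = - ((-1) ^ (i * j) *: term_br e' y x).
Proof.
rewrite -[x]treprK -[y]treprK -!tclass_br -tclassZ -tclassN.
exact/tclassP/cong_antisym.
Qed.

Fact term_br_jacobi i j k ij jk ik n
    (eij : i + j = ij) (ejk : j + k = jk) (eik : i + k = ik)
    (e1 : i + jk = n) (e2 : ij + k = n) (e3 : j + ik = n) x y z :
  term_br e1 x (term_br ejk y z) = term_br e2 (term_br eij x y) z +
    (-1) ^ (i * j) *: term_br e3 y (term_br eik x z).
Proof.
rewrite -[x]treprK -[y]treprK -[z]treprK -!tclass_br -tclassZ -tclassD.
exact/tclassP/cong_jacobi.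
Qed.

Definition term_glie : glie :=
  GLie term_br_linearl term_br_linearr term_br_antisym term_br_jacobi.

Fact term_emb_linear k : linear (fun x : A k => tclass (temb x) : term_glie k).
Proof.
by move=> a x y; rewrite -tclassZ -tclassD; apply/tclassP/cong_emb_lin.
Qed.

Fact term_emb_br i j k (e : i + j = k) (x : A i) (y : A j) :
  mklin (@term_emb_linear k) (br e x y) =
  br e (mklin (@term_emb_linear i) x) (mklin (@term_emb_linear j) y).
Proof. by rewrite /= -tclass_br; apply/tclassP/cong_emb_br. Qed.

Definition term_emb : glie_hom A term_glie :=
  @GLieHom A term_glie (fun k => mklin (@term_emb_linear k)) term_emb_br.

Definition term_sig_fun k (xy : (term_glie (k - 1) * Y k)%type) : term_glie k :=
  tclass (tsig (trepr xy.1) xy.2).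

Fact tclass_sig k (t : term (k - 1)) (y : Y k) :
  tclass (tsig t y) = term_sig_fun (tclass t, y).
Proof. by apply/tclassP/cong_sig/cong_sym/trepr_cong. Qed.

Fact term_sig_linear k : linear (@term_sig_fun k).
Proof.
move=> a [x y] [x' y'].
have -> : a *: (x, y) + (x', y') = (a *: x + x', a *: y + y') by [].
rewrite -[x]treprK -[x']treprK -tclassZ -tclassD -!tclass_sig.
by rewrite -tclassZ -tclassD; apply/tclassP/cong_sig_lin.
Qed.

Definition term_sig k : {linear (term_glie (k - 1) * Y k)%type ->
    term_glie k} :=
  mklin (@term_sig_linear k).

Section Universal.
Variables (K : glie) (u : glie_hom A K).
Variable h : forall k, {linear (term_glie (k - 1) * Y k)%type -> K k}.

(** The map [h] receives the class of the subterm [s] and not its value in [K]: elements in the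
    image of sigma behave as free generators, whose images may be any linear function of the
    pair. *)
Fixpoint teval k (t : term k) : K k :=
  match t in term k0 return K k0 with
  | tzero _ => 0
  | tadd _ s t => teval s + teval t
  | tscale _ a s => a *: teval s
  | tbr _ _ _ e s t => br e (teval s) (teval t)
  | temb _ x => u _ x
  | tsig k s y => h k (tclass s, y)
  end.

Lemma teval_cong k (s t : term k) : cong s t -> teval s = teval t.
Proof.
elim=> {k s t} //=.
- by move=> k s t v _ -> _ ->.
- by move=> k s s' t t' _ -> _ ->.
- by move=> k a s s' _ ->.
- by move=> i j k e s s' t t' _ -> _ ->.
- by move=> k s s' y /tclassP -> _.
- by move=> *; rewrite addrA.
- by move=> *; rewrite addrC.
- by move=> *; rewrite add0r.
- by move=> *; rewrite scaleN1r addNr.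
- by move=> *; rewrite scalerA.
- by move=> *; rewrite scale1r.
- by move=> *; rewrite scalerDr.
- by move=> *; rewrite scalerDl.
- by move=> *; rewrite br_linearl.
- by move=> *; rewrite br_linearr.
- by move=> *; rewrite scaleN1r; apply: br_antisym.
- by move=> *; apply: br_jacobi.
- by move=> *; rewrite linearP.
- by move=> *; rewrite glie_map_br.
- by move=> *; rewrite tclassD tclassZ -linearP.
Qed.

Definition term_eval k (x : term_glie k) : K k := teval (trepr x).

Lemma term_evalE k (t : term k) : term_eval (tclass t) = teval t.
Proof. exact/teval_cong/trepr_cong. Qed.

Fact term_eval_linear k : linear (@term_eval k).
Proof.
move=> a x y.
by rewrite -[x]treprK -[y]treprK -tclassZ -tclassD !term_evalE.
Qed.

Lemma term_universal : exists2 phi : glie_hom term_glie K,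
  (forall k x, phi k (term_emb k x) = u k x) &
  (forall k xy, phi k (term_sig k xy) = h k xy).
Proof.
have ebr i j k (e : i + j = k) x y : mklin (@term_eval_linear k) (br e x y) =
    br e (mklin (@term_eval_linear i) x) (mklin (@term_eval_linear j) y).
  by rewrite /= -[x]treprK -[y]treprK -tclass_br !term_evalE.
exists (@GLieHom _ K _ ebr) => [k x|k [x y]] /=; first by rewrite term_evalE.
by rewrite -[x]treprK -tclass_sig term_evalE.
Qed.

End Universal.
End Extension.

Lemma term_unique (A : glie) (Y : gspace) (K : glie)
    (phi psi : glie_hom (term_glie A Y) K) :
  (forall k x, phi k (term_emb A Y k x) = psi k (term_emb A Y k x)) ->
  (forall k xy, phi k (term_sig A Y k xy) = psi k (term_sig A Y k xy)) ->
  forall k x, phi k x = psi k x.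
Proof.
move=> eqe eqs k x; rewrite -[x]treprK; elim: {x}(trepr x) => {k}.
- move=> k; have -> : tclass (tzero A Y k) = 0 :> term_glie A Y k by [].
  by rewrite !linear0.
- by move=> k s IHs t IHt; rewrite tclassD !linearD IHs IHt.
- by move=> k a s IHs; rewrite tclassZ !linearZ IHs.
- move=> i j k e s IHs t IHt; rewrite tclass_br.
  by rewrite -[term_br _ _ _]/(br e _ _ : term_glie A Y k) !glie_map_br IHs IHt.
- by move=> k x; apply: eqe.
- by move=> k s _ y; rewrite tclass_sig; apply: eqs.
Qed.


(* The graded Lie algebra obtained from A by freely adjoining linear maps
   M (k - 1) * Y k -> M k. *)
Record extension (A : glie) (Y : gspace) := Extension {
  ext_glie :> glie;
  ext_emb : glie_hom A ext_glie;
  ext_sig : forall k, {linear (ext_glie (k - 1) * Y k)%type -> ext_glie k};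
  ext_universal : forall (K : glie) (u : glie_hom A K)
    (h : forall k, {linear (ext_glie (k - 1) * Y k)%type -> K k}),
    exists2 phi : glie_hom ext_glie K,
      (forall k x, phi k (ext_emb k x) = u k x) &
      (forall k xy, phi k (ext_sig k xy) = h k xy);
  ext_unique : forall (K : glie) (phi psi : glie_hom ext_glie K),
    (forall k x, phi k (ext_emb k x) = psi k (ext_emb k x)) ->
    (forall k xy, phi k (ext_sig k xy) = psi k (ext_sig k xy)) ->
    forall k x, phi k x = psi k x
}.

(** The quotient of terms serves only to realise the universal property, which is all that is used
    from here on. *)
Lemma extension_exists (A : glie) (Y : gspace) : inhabited (extension A Y).
Proof.
exact: (inhabits (Extension (@term_universal A Y) (@term_unique A Y))).
Qed.

(** * Generated subalgebras and derivations *)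

Section Span.
Variable M : glie.

Inductive lspan (S : forall k, M k -> Prop) : forall k, M k -> Prop :=
| lspan_gen k (x : M k) : S k x -> lspan S x
| lspan0 k : lspan S (0 : M k)
| lspanP k a (x y : M k) : lspan S x -> lspan S y -> lspan S (a *: x + y)
| lspan_br i j k (e : i + j = k) (x : M i) (y : M j) :
    lspan S x -> lspan S y -> lspan S (br e x y).

Lemma lspan_sub (S S' : forall k, M k -> Prop) :
  (forall k x, S k x -> lspan S' x) -> forall k (x : M k), lspan S x ->
    lspan S' x.
Proof.
move=> sub k x; elim=> {k x}; first exact: sub.
- exact: lspan0.
- by move=> *; apply: lspanP.
- by move=> *; apply: lspan_br.
Qed.

Definition lspan_subspace S k : subspace (M k) :=
  Subspace (lspan0 S k) (@lspanP S k).

Lemma lspanD S k (x y : M k) : lspan S x -> lspan S y -> lspan S (x + y).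
Proof. exact: (@smemD _ _ (lspan_subspace S k)). Qed.

Lemma lspanZ S k a (x : M k) : lspan S x -> lspan S (a *: x).
Proof. exact: (@smemZ _ _ (lspan_subspace S k)). Qed.

Lemma lspanN S k (x : M k) : lspan S x -> lspan S (- x).
Proof. exact: (@smemN _ _ (lspan_subspace S k)). Qed.

End Span.

Lemma glie_hom_span (M K : glie) (S : forall k, M k -> Prop)
    (phi psi : glie_hom M K) :
  (forall k x, S k x -> phi k x = psi k x) ->
  forall k (x : M k), lspan S x -> phi k x = psi k x.
Proof.
move=> eqS k x; elim=> {k x} //.
- by move=> k; rewrite !linear0.
- by move=> k a x y _ IHx _ IHy; rewrite !linearP IHx IHy.
- by move=> i j k e x y _ IHx _ IHy; rewrite !glie_map_br IHx IHy.
Qed.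

Section SubLie.
Variables (M : glie) (S : forall k, M k -> Prop).

Definition lspan_space : gspace :=
  GSpace (fun k => subsp (lspan_subspace S k) : lmodType rat).

Definition sspan_br i j k (e : i + j = k) (x : lspan_space i)
    (y : lspan_space j) :
  lspan_space k :=
  insp (S := lspan_subspace S k) (lspan_br e (subspP x) (subspP y)).

Fact sspan_br_linearl i j k (e : i + j = k) (a : rat) x x' y :
  sspan_br e (a *: x + x') y = a *: sspan_br e x y + sspan_br e x' y.
Proof. exact/val_inj/br_linearl. Qed.

Fact sspan_br_linearr i j k (e : i + j = k) (a : rat) x y y' :
  sspan_br e x (a *: y + y') = a *: sspan_br e x y + sspan_br e x y'.
Proof. exact/val_inj/br_linearr. Qed.

Fact sspan_br_antisym i j k (e : i + j = k) (e' : j + i = k) x y :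
  sspan_br e x y = - ((-1) ^ (i * j) *: sspan_br e' y x).
Proof. exact/val_inj/br_antisym. Qed.

Fact sspan_br_jacobi i j k ij jk ik n
    (eij : i + j = ij) (ejk : j + k = jk) (eik : i + k = ik)
    (e1 : i + jk = n) (e2 : ij + k = n) (e3 : j + ik = n) x y z :
  sspan_br e1 x (sspan_br ejk y z) = sspan_br e2 (sspan_br eij x y) z +
    (-1) ^ (i * j) *: sspan_br e3 y (sspan_br eik x z).
Proof. exact/val_inj/br_jacobi. Qed.

Definition lspan_glie : glie := GLie sspan_br_linearl sspan_br_linearr
  sspan_br_antisym sspan_br_jacobi.

Definition lspan_incl : glie_hom lspan_glie M :=
  @GLieHom lspan_glie M (fun k => subsp_incl (lspan_subspace S k))
    (fun _ _ _ _ _ _ => erefl).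

Definition in_span k (x : M k) (Sx : lspan S x) : lspan_glie k :=
  insp (S := lspan_subspace S k) Sx.

Lemma lspan_incl_inj k : injective (lspan_incl k).
Proof. exact: val_inj. Qed.

Lemma lspan_inclP k (x : lspan_glie k) : lspan S (lspan_incl k x).
Proof. exact: subspP x. Qed.

Lemma lspan_incl_in k (x : M k) (Sx : lspan S x) :
    lspan_incl k (in_span Sx) = x.
Proof. by []. Qed.

(** Generation can be tested inside the subalgebra: every intermediate element of a derivation from
    [S'] lies in the span of [S], so the derivation lifts along the injective inclusion. *)
Lemma lspan_lift (S' : forall k, M k -> Prop) :
    (forall k x, S' k x -> lspan S x) ->
  forall k (x : M k), lspan S' x ->
    forall y : lspan_glie k, lspan_incl k y = x ->
    lspan (fun j z => S' j (lspan_incl j z)) y.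
Proof.
move=> subS k x; elim=> {k x}.
- by move=> k x S'x y yx; apply: lspan_gen; rewrite yx.
- move=> k y y0; have -> : y = 0 by apply: lspan_incl_inj; rewrite linear0.
  exact: lspan0.
- move=> k a x y S'x IHx S'y IHy z zE.
  have Sx := lspan_sub subS S'x; have Sy := lspan_sub subS S'y.
  have -> : z = a *: in_span Sx + in_span Sy.
    by apply: lspan_incl_inj; rewrite linearP !lspan_incl_in.
  by apply: lspanP; [apply: IHx|apply: IHy].
- move=> i j k e x y S'x IHx S'y IHy z zE.
  have Sx := lspan_sub subS S'x; have Sy := lspan_sub subS S'y.
  have -> : z = br e (in_span Sx) (in_span Sy).
    by apply: lspan_incl_inj; rewrite glie_map_br !lspan_incl_in.
  by apply: lspan_br; [apply: IHx|apply: IHy].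
Qed.

Lemma hom_into_span (K : glie) (phi : glie_hom K M) :
    (forall k x, lspan S (phi k x)) ->
  exists psi : glie_hom K lspan_glie,
    forall k x, lspan_incl k (psi k x) = phi k x.
Proof.
move=> Sphi.
have lin k : linear (fun x => in_span (Sphi k x)).
  by move=> a x y; apply: lspan_incl_inj; rewrite [RHS]linearP;
    apply: (linearP (phi k)).
have pbr i j k (e : i + j = k) x y :
    mklin (lin k) (br e x y) = br e (mklin (lin i) x) (mklin (lin j) y).
  by apply: lspan_incl_inj; rewrite [RHS]glie_map_br; apply: (glie_map_br phi).
by exists (@GLieHom K lspan_glie (fun k => mklin (lin k)) pbr).
Qed.

End SubLie.

(** * Translation between derivations of degree -1 and differentials *)

Section OfDerivation.
Variables (L : glie) (D : forall k, {linear L k -> L (k - 1)}).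
Hypothesis D_derivation : derivation D.
Hypothesis D_square : forall k x, D (k - 1) (D k x) = 0.

Fact deg_pred (i j : int) : j + 1 = i -> i - 1 = j.
Proof. by move=> <-; rewrite addrK. Qed.

Fact dif_of_linear i j (e : j + 1 = i) :
  linear (fun x => gcast (deg_pred e) (D i x)).
Proof. by move=> a x y; rewrite linearP gcast_linear. Qed.

Definition dif_of i j (e : j + 1 = i) : {linear L i -> L j} :=
  mklin (dif_of_linear e).

Fact dif_of_sq i j k (e : j + 1 = i) (e' : k + 1 = j) x :
  dif_of e' (dif_of e x) = 0.
Proof.
rewrite /=; move: (deg_pred e) (deg_pred e') => p p'.
by move: p'; case: _ / p => p'; case: _ / p'; rewrite /= D_square.
Qed.

Fact dif_of_br i j k i' j' k' (e : i + j = k)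
    (ei : i' + 1 = i) (ej : j' + 1 = j) (ek : k' + 1 = k)
    (e1 : i' + j = k') (e2 : i + j' = k') x y :
  dif_of ek (br e x y) = br e1 (dif_of ei x) y +
    (-1) ^ i *: br e2 x (dif_of ej y).
Proof.
rewrite /=; move: (deg_pred ei) (deg_pred ej) (deg_pred ek) => pi pj pk.
move: e1 e2; clear ei ej ek; case: _ / pi; case: _ / pj; case: _ / pk => e1 e2.
exact: D_derivation.
Qed.

Definition dglie_of_derivation : dglie := DGLie dif_of_sq dif_of_br.

Lemma dif_ofE k (x : L k) :
    dif (d := dglie_of_derivation) (subrK 1 k) x = D k x.
Proof. exact: gcast_id. Qed.

End OfDerivation.

Section DglieDegree.
Variable L : dglie.

Definition dpred k : {linear L k -> L (k - 1)} := dif (subrK 1 k).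

Lemma difE i j (e : j + 1 = i) (x : L i) :
    dif e x = gcast (deg_pred e) (dpred i x).
Proof.
move: (deg_pred e) => p; move: e; case: _ / p => e /=.
by rewrite (eq_irrelevance e (subrK 1 i)).
Qed.

Lemma dpred_derivation : derivation dpred.
Proof. by move=> i j k e e1 e2 x y; apply: dif_br. Qed.

Lemma dpredK k (x : L k) : dpred (k - 1) (dpred k x) = 0.
Proof. exact: dif_dif. Qed.

Lemma dif_gcast i i' j (p : i = i') (e : j + 1 = i') (e' : j + 1 = i)
    (x : L i) :
  dif e (gcast p x) = dif e' x.
Proof.
by move: e; case: _ / p => e; rewrite /= (eq_irrelevance e e').
Qed.

End DglieDegree.

Lemma dpred_hom (L M : dglie) (phi : dglie_hom L M) k x :
  phi (k - 1) (dpred L k x) = dpred M k (phi k x).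
Proof. exact: dglie_map_dif. Qed.

Lemma dglie_hom_of_pred (L M : dglie) (phi : glie_hom L M) :
    (forall k x, phi (k - 1) (dpred L k x) = dpred M k (phi k x)) ->
  exists psi : dglie_hom L M, dglie_map psi = phi.
Proof.
move=> comm.
suff dphi i j (e : j + 1 = i) x : phi j (dif e x) = dif e (phi i x).
  by exists (DGLieHom dphi).
by rewrite difE [RHS]difE -comm; case: _ / (deg_pred e).
Qed.

(** The universal property, with target the dual numbers over [M], provides a morphism with
    prescribed eps-parts on the generators. Its eps-component is [D]. *)
Lemma ext_derivation (A : dglie) (Y : gspace) (M : extension A Y) :
  exists2 D : forall k, {linear M k -> M (k - 1)},
    derivation D &
    (forall k x, D k (ext_emb M k x) = ext_emb M (k - 1) (dpred A k x)) /\
    (forall k xy, D k (ext_sig M k xy) = xy.1).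
Proof.
set emb := ext_emb M; set sig := ext_sig M.
have ulin k : linear (fun x => (emb k x, emb (k - 1) (dpred A k x)) :
  dual_glie M k).
  by move=> a x y; congr pair; rewrite /= !linearP.
have ubr i j k (e : i + j = k) x y :
    mklin (ulin k) (br e x y) = br e (mklin (ulin i) x) (mklin (ulin j) y).
  congr pair; rewrite /= ?glie_map_br //.
  rewrite (dpred_derivation e (deg_predl e) (deg_predr e)).
  by rewrite linearD linearZ !glie_map_br.
have hlin k : linear (fun xy => (sig k xy, xy.1) : dual_glie M k).
  by move=> a x y; congr pair; rewrite /= linearP.
have [phi phie phis] := @ext_universal A Y M (dual_glie M) (GLieHom ubr)
  (fun k => mklin (hlin k)).
have flin k : linear (fun x => (phi k x).1) by move=> a x y; rewrite linearP.
have fbr i j k (e : i + j = k) x y :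
    mklin (flin k) (br e x y) = br e (mklin (flin i) x) (mklin (flin j) y).
  by rewrite /= glie_map_br.
have ilin k : linear (fun x : M k => x) by [].
(* The first component fixes the generators, so it is the identity. Multiplicativity of [phi] then
   says exactly that the second component is a derivation. *)
have phi1 := @ext_unique A Y M M (GLieHom fbr)
  (@GLieHom M M (fun k => mklin (ilin k)) (fun _ _ _ _ _ _ => erefl)).
have {}phi1 k x : (phi k x).1 = x.
  by apply: phi1 => {}k {}x; rewrite /= ?phie ?phis.
have Dlin k : linear (fun x => (phi k x).2) by move=> a x y; rewrite linearP.
exists (fun k => mklin (Dlin k)) => [i j k e e1 e2 x y|].
  rewrite /= glie_map_br /= !phi1 (br_irrel e1 (deg_predl e)).
  by rewrite (br_irrel e2 (deg_predr e)).
by split=> k x; rewrite /= ?phie ?phis.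
Qed.

(** * Quasi-isomorphisms and relatively free extensions *)

(** The hypothesis says that the mapping cone of [phi] is acyclic: (x, y) is a cone cycle, and u, y'
    exhibit it as a boundary. Injectivity on homology comes from the component [x], surjectivity
    from the case x = 0. *)
Lemma quasi_iso_of_acyclic (L M : dglie) (phi : dglie_hom L M) :
    (forall k (x : L (k - 1)) (y : M k),
      dpred L (k - 1) x = 0 -> phi (k - 1) x = dpred M k y ->
      exists u (y' : M (k + 1)),
        x = dpred L k u /\ y = phi k u - dif erefl y') ->
  quasi_iso phi.
Proof.
move=> acyc n.
have inj : injective (@homology_map _ _ phi n).
  move=> c c'; rewrite -[c]reprK -[c']reprK !homology_map_pi.
  move: (repr c) (repr c') => z z' /homology_eqP[y].
  rewrite /= -linearB => yE; apply/homology_eqP.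
  have cyc : dpred L n (val z - val z') = 0.
    by rewrite linearB (eqP (valP z)) (eqP (valP z')) subrr.
  move: yE cyc; rewrite /dpred /=; move: (val z - val z') => x.
  (* The degree n + 1 is generalised to [k] so that [n] can be replaced by [k - 1], the form in
     which [acyc] applies. *)
  have gen k (e : n + 1 = k) (y1 : M k) : dif e y1 = phi n x ->
      dpred L n x = 0 -> exists u : L k, dif e u = x.
    move=> + cyc; move: x cyc; move: (e);
      case: _ / (deg_pred e) => {}e x cyc yE.
    have [|u [_ [-> _]]] := acyc k x y1 cyc.
      by rewrite -yE /dpred (eq_irrelevance e (subrK 1 k)).
    by exists u; rewrite /dpred (eq_irrelevance e (subrK 1 k)).
  exact: gen.
have surj (c : homology M n) : exists c', homology_map phi c' = c.
  rewrite -[c]reprK; move: (repr c) => y.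
  have [||u [y' [u0 yE]]] := acyc n 0 (val y); first by rewrite linear0.
    by rewrite linear0 /dpred (eqP (valP y)).
  have cu : is_cycle u by apply/eqP.
  exists (\pi_(homology L n) (exist _ u cu)); rewrite homology_map_pi.
  by apply/homology_eqP; exists y'; rewrite /= yE opprB [RHS]addrC subrK.
pose inv c := projT1 (cid (surj c)).
have invK : cancel inv (@homology_map _ _ phi n).
  by move=> c; apply: (projT2 (cid (surj c))).
by exists inv => // c; apply: inj; rewrite invK.
Qed.

Lemma quasi_iso_inj (L M : dglie) (phi : dglie_hom L M) j k (e : j + 1 = k)
    (x : L j) (y : M k) : quasi_iso phi ->
  dpred L j x = 0 -> phi j x = dif e y -> exists u : L k, x = dif e u.
Proof.
case: _ / e y => y qi x0 xy.
have cx : is_cycle x by apply/eqP.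
have c0 : is_cycle (0 : L j) by rewrite /is_cycle linear0.
have [|u uE] := (homology_eqP (exist _ x cx) (exist _ 0 c0)).1.
  apply: (bij_inj (qi j)); rewrite !homology_map_pi; apply/homology_eqP.
  by exists y; rewrite /= linear0 subr0 xy.
by exists u; rewrite uE /= subr0.
Qed.

Lemma quasi_iso_surj (L M : dglie) (phi : dglie_hom L M) k (y : M k) :
  quasi_iso phi -> dpred M k y = 0 ->
  exists (x : L k) (z : M (k + 1)),
    dpred L k x = 0 /\ y = phi k x + dif erefl z.
Proof.
move=> qi y0; have cy : is_cycle y by apply/eqP.
have [inv _ invK] := qi k; pose c := inv (\pi_(homology M k) (exist _ y cy)).
have := invK (\pi_(homology M k) (exist _ y cy)); rewrite -/c -[c]reprK.
rewrite homology_map_pi => /esym/homology_eqP[z zE].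
exists (val (repr c)), z; split; first exact: (eqP (valP (repr c))).
by rewrite zE /= [RHS]addrC subrK.
Qed.

Section Composition.
Variables (L M N : glie) (psi : glie_hom M N) (phi : glie_hom L M).

Fact glie_comp_linear k : linear (fun x => psi k (phi k x)).
Proof. by move=> a x y; rewrite !linearP. Qed.

Fact glie_comp_br i j k (e : i + j = k) x y :
  mklin (glie_comp_linear (k := k)) (br e x y) =
  br e (mklin (glie_comp_linear (k := i)) x)
    (mklin (glie_comp_linear (k := j)) y).
Proof. by rewrite /= !glie_map_br. Qed.

Definition glie_comp : glie_hom L N := GLieHom glie_comp_br.
End Composition.

Fact glie_id_linear (L : glie) k : linear (fun x : L k => x).
Proof. by []. Qed.

Definition glie_id (L : glie) : glie_hom L L :=
  @GLieHom L L (fun k => mklin (@glie_id_linear L k))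
    (fun _ _ _ _ _ _ => erefl).

Section RelativelyFree.
Variables (A L : glie) (iota : glie_hom A L) (W : forall k, subspace (L k)).

(* L is the coproduct of A with the free graded Lie algebra on W; the test map
   on W is given as the restriction of a linear map on L. *)
Definition relatively_free :=
  (forall (K : glie) (u : glie_hom A K) (h : forall k, {linear L k -> K k}),
    exists2 psi : glie_hom L K,
      (forall k x, psi k (iota k x) = u k x) &
      (forall k w, W k w -> psi k w = h k w)) /\
  (forall k (x : L k),
     lspan (fun j y => (exists a, y = iota j a) \/ W j y) x).

(** Only the generators of the stage L(n); the stage itself is the [lspan] of this family. *)
Definition filtration (n : nat) k (x : L k) :=
  (exists a, x = iota k a) \/ (k <= n%:Z /\ W k x).

Hypothesis L_free : relatively_free.

(** Extending the identity of [A] by zero on [W] gives a left inverse of [iota]. *)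
Lemma relatively_free_inj k : injective (iota k).
Proof.
have [psi psiK _] := L_free.1 A (glie_id A) (fun k => \0).
by move=> x y /(congr1 (psi k)); rewrite !psiK.
Qed.

Definition gen_space : gspace := GSpace (fun k => subsp (W k) : lmodType rat).

Fact rel_gen_linear (V : gspace) (eta : ghom V A) k :
  linear (fun vw : gsum V gen_space k => iota k (eta k vw.1) + val vw.2).
Proof.
move=> a [v w] [v' w'].
have -> : a *: (v, w) + (v', w') = (a *: v + v', a *: w + w') by [].
by rewrite !linearP scalerDr addrACA.
Qed.

Definition rel_gen (V : gspace) (eta : ghom V A) : ghom (gsum V gen_space) L :=
  fun k => mklin (@rel_gen_linear V eta k).

(** A test map on the sum of V and W splits: its V-part extends over [A] by freeness of [A], and its
    W-part then extends over [L] by relative freeness. *)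
Lemma rel_gen_free (V : gspace) (eta : ghom V A) :
  free_glie_on eta -> free_glie_on (rel_gen eta).
Proof.
move=> A_free K h.
have lin0 k : linear (fun v => h k (v, 0)).
  move=> a x y; rewrite -linearP; congr (h k _).
  by apply: injective_projections; rewrite /= ?scaler0 ?addr0.
have [u uE uU] := A_free K (fun k => mklin (lin0 k)).
(* Relative freeness takes test maps defined on all of [L], so the W-part of [h] is first
   precomposed with a retraction onto [W]. *)
pose r k := projT1 (cid (linear_retraction (W k))).
have rK k w : r k (val w) = w := projT2 (cid (linear_retraction (W k))) w.
have linr k : linear (fun x => h k (0, r k x)).
  move=> a x y; rewrite -linearP; congr (h k _).
  by apply: injective_projections; rewrite /= ?scaler0 ?addr0 ?linearP.
have [psi psiA psiW] := L_free.1 K u (fun k => mklin (linr k)).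
exists psi => [k [v w]|psi' psi'E k x].
  rewrite /= linearD psiA uE psiW /=; last exact: subspP.
  by rewrite rK -linearD; congr (h k _); congr pair; rewrite ?addr0 ?add0r.
apply: (glie_hom_span _ (L_free.2 k x)) => {}k {}x [[a ->]|Wx].
  rewrite psiA; apply: (uU (glie_comp psi' iota)) => j v.
  by rewrite /= -psi'E /= addr0.
rewrite psiW //= -(psi'E k (0, r k x)) /= linear0 linear0 add0r.
by rewrite -[x in LHS]/(val (insp Wx)) -[x in RHS]/(val (insp Wx)) rK.
Qed.

End RelativelyFree.

(** The inverse is built at once as a morphism [psi] of graded Lie algebras, equal to [beta] on [A]
    and to a linear pseudo-inverse of [phi] on [W]. Induction on n shows that it inverts [phi] on
    both sides over each stage; compatibility with the differential then follows from that of
    [phi]. *)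
Lemma rigidity (A L : dglie) (iota : dglie_hom A L)
    (W : forall k, subspace (L k)) :
    relatively_free iota W -> simply_connected L ->
    (forall n k (x : L k), k <= n%:Z -> lspan (filtration iota W n) x) ->
    (forall n j k (e : j + 1 = k) (x : L k), j = n.+1%:Z ->
       lspan (filtration iota W n) (dif e x)) ->
  forall phi : dglie_hom L L, quasi_iso phi ->
    (exists2 alpha : dglie_hom A A, dglie_automorphism alpha &
       forall n x, phi n (iota n x) = iota n (alpha n x)) ->
  dglie_automorphism phi.
Proof.
move=> L_free scL lowdeg minim phi qi [alpha [beta betaK] phiA].
pose s k := projT1 (cid (pseudo_inverse (phi k))).
have sP k x : phi k (s k (phi k x)) = phi k x :=
  projT2 (cid (pseudo_inverse (phi k))) x.
have [psi psiA psiW] := L_free.1 L (glie_comp iota beta) s.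
have phi_psi_span (S : forall k, L k -> Prop) :
    (forall k x, S k x -> phi k (psi k x) = x) ->
    forall k (x : L k), lspan S x -> phi k (psi k x) = x.
  exact: (@glie_hom_span L L S (glie_comp phi psi) (glie_id L)).
have psi_phi_span (S : forall k, L k -> Prop) :
    (forall k x, S k x -> psi k (phi k x) = x) ->
    forall k (x : L k), lspan S x -> psi k (phi k x) = x.
  exact: (@glie_hom_span L L S (glie_comp psi phi) (glie_id L)).
have inv n : (forall k (x : L k), lspan (filtration iota W n) x ->
      phi k (psi k x) = x) /\
    (forall k (x : L k), lspan (filtration iota W n) x -> psi k (phi k x) = x).
  have phi_psiA k x : phi k (psi k (iota k x)) = iota k x.
    by rewrite psiA phiA; have [_ ->] := betaK k.
  have psi_phiA k x : psi k (phi k (iota k x)) = iota k x.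
    by rewrite phiA psiA /=; have [-> _] := betaK k.
  elim: n => [|n [IH1 IH2]].
    (* No generator has degree at most 0, so stage 0 is the image of [A]. *)
    have W0 k x : k <= 0 -> W k x -> x = 0 by move=> k0 _; apply: scL; lia.
    split; [apply: phi_psi_span|apply: psi_phi_span];
      by move=> k _ [[x ->]|[k0 /W0->]] //; rewrite !linear0.
  have closed k (x : L k) : k = n.+1%:Z -> phi (k - 1) (dpred L k x) = 0 ->
      dpred L k x = 0.
    move=> kn phix0; rewrite -(IH2 _ (dpred L k x)) ?phix0 ?linear0 //.
    by apply: lowdeg; lia.
  have phi_psiW k (w : L k) : k = n.+1%:Z -> W k w -> phi k (psi k w) = w.
    move=> kn Ww; rewrite psiW //.
    (* Since [phi] after [s] fixes the image of [phi], it is enough that [w] lies in this image. *)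
    suff [t ->] : exists t, w = phi k t by rewrite sP.
    (* The boundary of [w] has degree n, so it equals [phi x] with [x] a cycle. As [phi] is a
       quasi-isomorphism, x = du, and the cycle phi u - w equals phi c + dz. By minimality dz lies
       in stage n, where [phi] is already inverted, so w = phi (u - c - psi (dz)). *)
    have low : lspan (filtration iota W n) (dpred L k w) by apply: lowdeg; lia.
    have phix := IH1 _ _ low; set x := psi _ _ in phix.
    have x0 : dpred L (k - 1) x = 0.
      rewrite -(IH2 _ (dpred L (k - 1) x)); last by apply: lowdeg; lia.
      by rewrite dpred_hom phix dpredK linear0.
    have [u xu] := quasi_iso_inj qi x0 phix.
    have [|c [z [_ phiuE]]] := @quasi_iso_surj _ _ phi k (phi k u - w) qi.
      by rewrite linearB -dpred_hom -[dpred L k u]xu phix subrr.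
    exists (u - c - psi k (dif erefl z)).
    rewrite !linearB IH1; last exact: minim.
    by rewrite -addrA -opprD -phiuE opprB [RHS]addrC subrK.
  have phi_psi k x : lspan (filtration iota W n.+1) x -> phi k (psi k x) = x.
    apply: phi_psi_span => {}k {}x [[a ->]|[kn Wx]]; first exact: phi_psiA.
    have [kE|kE] := eqVneq k n.+1%:Z; first exact: phi_psiW.
    by apply: IH1; apply: lspan_gen; right; split=> //; lia.
  split=> //; apply: psi_phi_span => k x [[a ->]|[kn Wx]];
    first exact: psi_phiA.
  have [kE|kE] := eqVneq k n.+1%:Z; last first.
    by apply: IH2; apply: lspan_gen; right; split=> //; lia.
  (* The defect [v] is a cycle killed by [phi], hence a boundary. Minimality places it in stage n,
     where [phi] is injective, so it vanishes. *)
  apply/eqP; rewrite -subr_eq0; set v := _ - _; apply/eqP.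
  have phiv : phi k v = 0.
    by rewrite linearB phi_psi ?subrr //; apply: lowdeg.
  have v0 : dpred L k v = 0.
    by apply: closed => //; rewrite dpred_hom phiv linear0.
  have [|z vz] := @quasi_iso_inj _ _ phi k (k + 1) erefl v 0 qi v0.
    by rewrite phiv linear0.
  rewrite vz -(IH2 _ (dif erefl z)); last exact: minim.
  by rewrite -vz phiv linear0.
have psi_phi k x : psi k (phi k x) = x.
  by apply: (inv `|k|%N).2; apply: lowdeg; lia.
have phi_psi k x : phi k (psi k x) = x.
  by apply: (inv `|k|%N).1; apply: lowdeg; lia.
have [|psi' psiE] := @dglie_hom_of_pred L L psi.
  by move=> k x; rewrite -{1}(phi_psi k x) -dpred_hom psi_phi.
by exists psi' => n; rewrite psiE; split=> x; [apply: psi_phi|apply: phi_psi].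
Qed.

(** * The minimal relative model *)

Section Stages.
Variables (A g : dglie) (f : dglie_hom A g) (M : extension A g).
Variables (D : forall k, {linear M k -> M (k - 1)}) (q : glie_hom M g).
Hypotheses (D_der : derivation D)
  (D_emb : forall k x, D k (ext_emb M k x) = ext_emb M (k - 1) (dpred A k x))
  (D_sig : forall k xy, D k (ext_sig M k xy) = xy.1)
  (q_emb : forall k x, q k (ext_emb M k x) = f k x)
  (q_sig : forall k xy, q k (ext_sig M k xy) = xy.2).
Hypotheses (scA : simply_connected A) (scg : simply_connected g).

(** The degree k part of the mapping cone of [q]. *)
Definition cone k : lmodType rat := (M (k - 1) * g k)%type.

Definition gens (P : forall k, subspace (cone k)) k (z : M k) :=
  (exists x, z = ext_emb M k x) \/ (exists2 xy, P k xy & z = ext_sig M k xy).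

(** The cycles, and next the boundaries, of the cone of [q] restricted to the subalgebra generated
    by [A] and the elements sigma (x, y) with (x, y) in [P]. *)
Definition relcycle (P : forall k, subspace (cone k)) k : subspace (cone k).
Proof.
exists (fun xy => [/\ lspan (gens P) xy.1, D (k - 1) xy.1 = 0 &
                      q (k - 1) xy.1 = dpred g k xy.2]).
- by split=> /=; [apply: lspan0|rewrite linear0|rewrite !linear0].
- move=> a x y [Sx Dx qx] [Sy Dy qy]; split=> /=; first exact: lspanP.
    by rewrite linearP Dx Dy scaler0 addr0.
  by rewrite !linearP qx qy.
Defined.

Definition relboundary (P : forall k, subspace (cone k)) k : subspace (cone k).
Proof.
exists (fun xy => exists u (y : g (k + 1)), [/\ lspan (gens P) u,
  xy.1 = D k u & xy.2 = q k u - dif erefl y]).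
- by exists 0, 0; split;
  [apply: lspan0|rewrite !linear0|rewrite !linear0 addr0].
- move=> a x y [u [v [Su xu xv]]] [u' [v' [Su' xu' xv']]].
  exists (a *: u + u'), (a *: v + v'); split=> /=; first exact: lspanP.
    by rewrite linearP xu xu'.
  by rewrite !linearP xv xv' /= scalerDr addrACA.
Defined.

(* A complement of the relative boundaries represents the relative homology of
   the previous stage, which the new generators kill. *)
Fixpoint stage (n : nat) : forall k, subspace (cone k) :=
  if n is n'.+1 then
    fun k => if k == n'.+1%:Z then
               complement (relcycle (stage n') k) (relboundary (stage n') k)
             else stage n' k
  else fun k => trivial_subspace (cone k).

(** The choice in degree k > 0 is made at stage k and never revised, so it can be read off there. In
    degrees k < 1 every stage is trivial. *)
Definition limit k : subspace (cone k) := stage `|k|%N k.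

Lemma stage_triv n k xy : ~~ (1 <= k <= n%:Z) -> stage n k xy -> xy = 0.
Proof.
elim: n => [//|n IHn] /= kn; case: eqVneq => [kE|_]; first by lia.
by apply: IHn; lia.
Qed.

Lemma stage_succ n k : k = n.+1%:Z ->
  stage n.+1 k = complement (relcycle (stage n) k) (relboundary (stage n) k).
Proof. by move=> -> /=; rewrite eqxx. Qed.

Lemma stage_limit n k : 1 <= k <= n%:Z -> stage n k = limit k.
Proof.
elim: n => [|n IHn] kn; first lia.
have [->|kn1] := eqVneq k n.+1%:Z; first by [].
by rewrite /= (negPf kn1) IHn //; lia.
Qed.

Lemma limit_triv k xy : k < 1 -> limit k xy -> xy = 0.
Proof. by move=> k1; apply: stage_triv; lia. Qed.

Lemma stage_sub_limit n k xy : stage n k xy -> limit k xy.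
Proof.
have [kn|kn] := boolP (1 <= k <= n%:Z); first by rewrite stage_limit.
by move=> /(stage_triv kn) ->; apply: smem0.
Qed.

Lemma stage_sub n m k xy : (n <= m)%N -> stage n k xy -> stage m k xy.
Proof.
have [kn nm|kn _] := boolP (1 <= k <= n%:Z); first by rewrite !stage_limit //;
  lia.
by move=> /(stage_triv kn) ->; apply: smem0.
Qed.

Lemma gens_sub (P P' : forall k, subspace (cone k)) :
    (forall k xy, P k xy -> P' k xy) ->
  forall k (z : M k), lspan (gens P) z -> lspan (gens P') z.
Proof.
move=> sub; apply: lspan_sub => k z [[x ->]|[xy Pxy ->]]; apply: lspan_gen.
  by left; exists x.
by right; exists xy => //; apply: sub.
Qed.

Lemma lspan_stage_limit n k (z : M k) :
  lspan (gens (stage n)) z -> lspan (gens limit) z.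
Proof. by apply: gens_sub; apply: stage_sub_limit. Qed.

Lemma lspan_stage_sub n m k (z : M k) : (n <= m)%N ->
  lspan (gens (stage n)) z -> lspan (gens (stage m)) z.
Proof. by move=> nm; apply: gens_sub => j xy; apply: stage_sub. Qed.

Lemma lspan_limit_sc k (z : M k) : k < 1 -> lspan (gens limit) z -> z = 0.
Proof.
move=> + Sz; elim: Sz => {k z} //.
- move=> k z [[x ->]|[xy Pxy ->]] k1; first by rewrite (scA k1 x) linear0.
  by rewrite (limit_triv k1 Pxy) linear0.
- by move=> k a x y _ IHx _ IHy k1; rewrite IHx // IHy // scaler0 addr0.
- move=> i j k e x y _ IHx _ IHy k1.
  have [i1|i1] := ltP i 1; first by rewrite IHx // br0l.
  by rewrite IHy ?br0r //; lia.
Qed.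

(** As the generated subalgebra lives in positive degrees, only brackets of two factors of positive
    degree matter; each factor then has degree strictly below k. *)
Lemma br_sc_ind i j k (e : i + j = k) (x : M i) (y : M j) (Q : M k -> Prop) :
  lspan (gens limit) x -> lspan (gens limit) y -> Q 0 ->
  (1 <= i -> 1 <= j -> Q (br e x y)) -> Q (br e x y).
Proof.
move=> Sx Sy Q0 Qpos.
have [i1|i1] := ltP i 1; first by rewrite (lspan_limit_sc i1 Sx) br0l.
have [j1|j1] := ltP j 1; first by rewrite (lspan_limit_sc j1 Sy) br0r.
exact: Qpos.
Qed.

(** Factors of a nonzero bracket have smaller degree than the bracket, so generators of degree above
    n cannot contribute in degree at most n. *)
Lemma lspan_limit_stage n k (z : M k) : k <= n%:Z ->
  lspan (gens limit) z -> lspan (gens (stage n)) z.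
Proof.
move=> + Sz; elim: Sz => {k z}.
- move=> k z [[x ->]|[xy Pxy ->]] kn; first by apply: lspan_gen; left; exists x.
  have [k1|k1] := ltP k 1; first by rewrite (limit_triv k1 Pxy) linear0;
    apply: lspan0.
  by apply: lspan_gen; right; exists xy => //; rewrite stage_limit ?k1.
- by move=> k _; apply: lspan0.
- by move=> k a x y _ IHx _ IHy kn; apply: lspanP; [apply: IHx|apply: IHy].
- move=> i j k e x y Sx IHx Sy IHy kn.
  apply: (br_sc_ind Sx Sy) => [|i1 j1]; first exact: lspan0.
  by apply: lspan_br; [apply: IHx|apply: IHy]; lia.
Qed.

(** New generators are chosen among relative cycles of the stage before. This is why [D] preserves
    the generated subalgebra and squares to zero on it, and why [q] is a chain map there. *)
Lemma stage_relcycle n k xy : stage n k xy -> relcycle (stage n) k xy.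
Proof.
elim: n => [|n IHn]; first by move=> /= ->;
  apply: (smem0 (relcycle (stage 0) k)).
have sub : relcycle (stage n) k xy -> relcycle (stage n.+1) k xy.
  by case=> S1 D1 q1; split=> //; apply: lspan_stage_sub S1.
have [kE|kn] := eqVneq k n.+1%:Z; last by rewrite /= (negPf kn) => /IHn.
rewrite (stage_succ kE) => Cxy; apply: sub.
by have [+ _ _] :=
  complementP (relcycle (stage n) k) (relboundary (stage n) k); apply.
Qed.

Lemma limit_relcycle k xy : limit k xy -> relcycle limit k xy.
Proof.
by move=> /stage_relcycle[S1 D1 q1]; split=> //; apply: lspan_stage_limit S1.
Qed.

Lemma lspan_stage_D n k (z : M k) :
  lspan (gens (stage n)) z -> lspan (gens (stage n)) (D k z).
Proof.
elim=> {k z}.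
- move=> k z [[x ->]|[xy Pxy ->]].
    by rewrite D_emb; apply: lspan_gen; left; eexists.
  by rewrite D_sig; have [] := stage_relcycle Pxy.
- by move=> k; rewrite linear0; apply: lspan0.
- by move=> k a x y _ Sx _ Sy; rewrite linearP; apply: lspanP.
- move=> i j k e x y Sx SDx Sy SDy.
  rewrite (D_der e (deg_predl e) (deg_predr e)).
  by apply: lspanD; last apply: lspanZ; apply: lspan_br.
Qed.

Lemma lspan_limit_D k (z : M k) : lspan (gens limit) z ->
    lspan (gens limit) (D k z).
Proof.
have kn : k <= `|k|%N%:Z by lia.
by move=> /(lspan_limit_stage kn)/lspan_stage_D/lspan_stage_limit.
Qed.

Lemma lspan_limit_DD k (z : M k) : lspan (gens limit) z ->
    D (k - 1) (D k z) = 0.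
Proof.
elim=> {k z}.
- move=> k z [[x ->]|[xy Pxy ->]]; first by rewrite !D_emb dpredK linear0.
  by rewrite D_sig; have [] := limit_relcycle Pxy.
- by move=> k; rewrite !linear0.
- by move=> k a x y _ DDx _ DDy; rewrite !linearP /= DDx DDy scaler0 addr0.
- move=> i j k e x y _ DDx _ DDy; pose el := deg_predl e;
  pose er := deg_predr e.
  rewrite (D_der e el er) linearD linearZ /=.
  rewrite (D_der el (deg_predl el) (deg_predr el)).
  (* The two mixed terms [Dx, Dy] carry the opposite signs (-1)^(i-1) and (-1)^i. *)
  rewrite (D_der er (deg_predl er) (deg_predr er)) DDx DDy br0l br0r add0r.
  rewrite scaler0 addr0 signzB1 (br_irrel (deg_predr el) (deg_predl er)).
  by rewrite scaleNr addNr.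
Qed.

Lemma lspan_limit_qD k (z : M k) :
  lspan (gens limit) z -> q (k - 1) (D k z) = dpred g k (q k z).
Proof.
elim=> {k z}.
- move=> k z [[x ->]|[xy Pxy ->]]; first by rewrite D_emb !q_emb dpred_hom.
  by rewrite D_sig q_sig; have [] := limit_relcycle Pxy.
- by move=> k; rewrite !linear0.
- by move=> k a x y _ IHx _ IHy; rewrite !linearP /= IHx IHy.
- move=> i j k e x y _ IHx _ IHy; pose el := deg_predl e;
  pose er := deg_predr e.
  rewrite (D_der e el er) linearD linearZ !glie_map_br IHx IHy.
  by rewrite (dpred_derivation e el er).
Qed.

(** In degree n + 1 a new generator can occur only linearly, because the factors of a bracket have
    degree at most n. *)
Lemma lspan_stage_top n k (z : M k) : k = n.+1%:Z -> lspan (gens limit) z ->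
  exists2 xy, stage n.+1 k xy & lspan (gens (stage n)) (z - ext_sig M k xy).
Proof.
move=> + Sz; elim: Sz => {k z}.
- move=> k z [[x ->]|[xy Pxy ->]] kn.
    by exists 0; [apply: smem0|rewrite linear0 subr0; apply: lspan_gen; left;
      exists x].
  by exists xy; rewrite ?stage_limit // ?subrr; [lia|apply: lspan0].
- by move=> k _; exists 0; [apply: smem0|rewrite linear0 subr0; apply: lspan0].
- move=> k a x y _ IHx _ IHy kn.
  have [u Pu Su] := IHx kn; have [v Pv Sv] := IHy kn.
  exists (a *: u + v); first exact: smemP.
  by rewrite linearP opprD addrACA -scalerBr; apply: lspanP.
- move=> i j k e x y Sx _ Sy _ kn; exists 0; first exact: smem0.
  rewrite linear0 subr0; apply: (br_sc_ind Sx Sy) => [|i1 j1];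
    first exact: lspan0.
  by apply: lspan_br; apply: lspan_limit_stage => //; lia.
Qed.

(* Minimality: the differential has no linear component along new generators. *)
Lemma stage_minimal n k (z : M k) : k = n.+2%:Z -> lspan (gens limit) z ->
  lspan (gens (stage n)) (D k z).
Proof.
move=> + Sz; elim: Sz => {k z}.
- move=> k z [[x ->]|[xy Pxy ->]] kn.
    by rewrite D_emb; apply: lspan_gen; left; eexists.
  have k1n : k - 1 = n.+1%:Z by lia.
  have [S1 D1 q1] := limit_relcycle Pxy; rewrite D_sig.
  have [uv Puv Suv] := lspan_stage_top k1n S1.
  suff -> : xy.1 = xy.1 - ext_sig M (k - 1) uv by [].
  (* Here [xy.1] is sigma uv plus some x' of stage n. As [xy.1] is a cycle whose image under [q] is
     the boundary of [xy.2], applying [D] and [q] shows that [uv] is the relative boundary given by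
     -x' and [- xy.2]. But [uv] lies in the complement of these boundaries. *)
  suff -> : uv = 0 by rewrite linear0 subr0.
  move: Puv; rewrite (stage_succ k1n) => Puv.
  have [_ + _] := complementP (relcycle (stage n) (k - 1))
                              (relboundary (stage n) (k - 1)).
  apply=> //.
  have kE : k = k - 1 + 1 by rewrite subrK.
  exists (- (xy.1 - ext_sig M (k - 1) uv)), (gcast kE (- xy.2)); split.
  - exact: lspanN.
  - by rewrite linearN linearB D1 D_sig sub0r opprK.
  - rewrite linearN linearB q1 q_sig (dif_gcast kE erefl (subrK 1 k)).
    by rewrite -/(dpred g k) linearN opprK opprB subrK.
- by move=> k _; rewrite linear0; apply: lspan0.
- move=> k a x y _ IHx _ IHy kn.
  by rewrite linearP; apply: lspanP; [apply: IHx|apply: IHy].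
- move=> i j k e x y Sx _ Sy _ kn.
  apply: (@br_sc_ind _ _ _ e x y (fun z => lspan (gens (stage n))
    (D k z)) Sx Sy).
    by rewrite linear0; apply: lspan0.
  move=> i1 j1.
  rewrite (D_der e (deg_predl e) (deg_predr e)).
  apply: lspanD; last apply: lspanZ.
    (* If [j] exceeds n, then i = 1 and Dx has degree 0, hence vanishes. Otherwise both factors have
       degree at most n. The second term is symmetric. *)
    have [jn|jn] := leP j n%:Z.
      by apply: lspan_br; apply: lspan_limit_stage => //;
        [lia|apply: lspan_limit_D].
    rewrite (lspan_limit_sc _ (lspan_limit_D Sx)) ?br0l; [exact: lspan0|lia].
  have [jn|jn] := leP i n%:Z.
    by apply: lspan_br; apply: lspan_limit_stage => //;
      [lia|apply: lspan_limit_D].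
  rewrite (lspan_limit_sc _ (lspan_limit_D Sy)) ?br0r; [exact: lspan0|lia].
Qed.

(** In degree k = n + 1 a cone cycle splits into a chosen [c] and a relative boundary of stage n.
    The new generator sigma c satisfies D (sigma c) = c.1 and q (sigma c) = c.2, so [c] becomes a
    boundary too. *)
Lemma limit_acyclic k (x : M (k - 1)) (y : g k) : lspan (gens limit) x ->
    D (k - 1) x = 0 -> q (k - 1) x = dpred g k y ->
  exists u (y' : g (k + 1)),
    [/\ lspan (gens limit) u, x = D k u & y = q k u - dif erefl y'].
Proof.
move=> Sx Dx qx; have [k1|k1] := ltP k 1.
  exists 0, 0; split; first exact: lspan0.
    by rewrite linear0; apply: lspan_limit_sc Sx; lia.
  by rewrite !linear0 addr0; apply: scg.
have [n kn] : exists n, k = n.+1%:Z by exists `|k - 1|%N; lia.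
have [_ _ dec] := complementP (relcycle (stage n) k) (relboundary (stage n) k).
have [|c Cc [u [y' [Su xu yu]]]] := dec (x, y).
  by split=> //; apply: lspan_limit_stage => //=; lia.
exists (u + ext_sig M k c), y'; split.
- apply: lspanD; first exact: lspan_stage_limit Su.
  apply: lspan_gen; right; exists c => //; apply: (@stage_sub_limit n.+1).
  by rewrite (stage_succ kn).
- by rewrite linearD -xu D_sig subrK.
- by rewrite linearD addrAC -yu q_sig subrK.
Qed.


(** * The model as a dg Lie algebra inside [M] *)

Definition model_lie : glie := lspan_glie (gens limit).

Let incl : glie_hom model_lie M := lspan_incl (gens limit).

Definition model_D_fun k (x : model_lie k) : model_lie (k - 1) :=
  in_span (lspan_limit_D (lspan_inclP x)).

Lemma model_D_funE k (x : model_lie k) :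
  incl (k - 1) (model_D_fun x) = D k (incl k x).
Proof. by []. Qed.

Fact model_D_linear k : linear (@model_D_fun k).
Proof.
move=> a x y; apply: lspan_incl_inj.
by rewrite [RHS]linearP -!/(incl _) !model_D_funE !linearP.
Qed.

Definition model_D k : {linear model_lie k -> model_lie (k - 1)} :=
  mklin (@model_D_linear k).

Lemma model_DE k (x : model_lie k) :
    incl (k - 1) (model_D k x) = D k (incl k x).
Proof. by []. Qed.

Fact model_D_derivation : derivation model_D.
Proof.
move=> i j k e e1 e2 x y; apply: (@lspan_incl_inj M (gens limit)).
rewrite -/incl [RHS]linearD [X in _ = _ + X]linearZ.
by rewrite model_DE !glie_map_br !model_DE; apply: D_der.
Qed.

Fact model_D_square k x : model_D (k - 1) (model_D k x) = 0.
Proof.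
apply: (@lspan_incl_inj M (gens limit)); rewrite linear0 -/incl !model_DE.
exact: lspan_limit_DD (lspan_inclP x).
Qed.

Definition model : dglie :=
    dglie_of_derivation model_D_derivation model_D_square.

Lemma model_dpred k (x : model k) : dpred model k x = model_D k x.
Proof. exact: dif_ofE. Qed.

Definition model_gen k : subspace (model k).
Proof.
exists (fun x => exists2 xy, limit k xy & incl k x = ext_sig M k xy).
  by exists 0; [apply: smem0|rewrite !linear0].
move=> a x y [u Pu xu] [v Pv yv]; exists (a *: u + v); first exact: smemP.
by rewrite linearP [RHS]linearP xu yv.
Defined.

Lemma model_simply_connected : simply_connected model.
Proof.
move=> k k1 x; apply: (@lspan_incl_inj M (gens limit)).
by rewrite linear0; apply: lspan_limit_sc k1 (lspan_inclP x).
Qed.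

Lemma model_iota_exists : exists iota : dglie_hom A model,
  forall k x, incl k (iota k x) = ext_emb M k x.
Proof.
have [|iota iotaE] := @hom_into_span M (gens limit) A (ext_emb M).
  by move=> k x; apply: lspan_gen; left; exists x.
have [|iota' iota'E] := @dglie_hom_of_pred A model iota.
  move=> k x; rewrite model_dpred; apply: (@lspan_incl_inj M (gens limit)).
  by rewrite -/incl model_DE !iotaE D_emb.
by exists iota'; rewrite iota'E.
Qed.

Lemma model_q_exists : exists q' : dglie_hom model g,
  forall k x, q' k x = q k (incl k x).
Proof.
have [|q' q'E] := @dglie_hom_of_pred model g (glie_comp q incl).
  move=> k x; rewrite model_dpred.
  exact: lspan_limit_qD (lspan_inclP x).
by exists q'; rewrite q'E.
Qed.

Lemma model_quasi_iso (q' : dglie_hom model g) :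
  (forall k x, q' k x = q k (incl k x)) -> quasi_iso q'.
Proof.
move=> q'E; apply: quasi_iso_of_acyclic => k x y.
rewrite model_dpred => x0; rewrite q'E => qx.
have [|u [y' [Su xu yu]]] := limit_acyclic (lspan_inclP x) _ qx.
  by rewrite -/incl -model_DE x0 linear0.
exists (in_span Su), y'; split; last by rewrite q'E.
by rewrite model_dpred; apply: (@lspan_incl_inj M (gens limit)).
Qed.

Section Generation.
Variable iota : dglie_hom A model.
Hypothesis iotaE : forall k x, incl k (iota k x) = ext_emb M k x.

(** Transfers generation from [M] to the model; it is applied both to the single stages and to their
    limit. *)
Lemma model_generated (P : forall k, subspace (cone k))
    (S : forall k, model k -> Prop) :
    (forall k xy, P k xy -> limit k xy) ->
    (forall k a, S k (iota k a)) ->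
    (forall k xy x, P k xy -> incl k x = ext_sig M k xy -> S k x) ->
  forall k (x : model k), lspan (gens P) (incl k x) -> lspan S x.
Proof.
move=> PL Sa Sw k x Px.
have sub j z : gens P z -> lspan (gens limit) (z : M j).
  by move=> Pz; apply: (gens_sub PL); apply: lspan_gen.
apply: (lspan_sub _ (lspan_lift sub Px (erefl _))) => j y.
move=> [[a ya]|[xy Pxy yE]]; apply: lspan_gen; last exact: Sw Pxy yE.
suff -> : y = iota j a by [].
by apply: (@lspan_incl_inj M (gens limit)); rewrite -/incl ya iotaE.
Qed.

Lemma model_filtration n k (x : model k) : lspan (gens (stage n)) (incl k x) ->
  lspan (filtration iota model_gen n) x.
Proof.
apply: model_generated => {k x}; first exact: stage_sub_limit.
  by move=> k a; left; exists a.
move=> k xy x Pxy xE; have [kn|kn] := boolP (1 <= k <= n%:Z).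
  by right; split; [lia|exists xy => //; apply: (stage_sub_limit Pxy)].
(* Outside the degrees 1 to n the stage is trivial, so this generator is zero and counts as the
   image of 0 from [A]. *)
left; exists 0; apply: (@lspan_incl_inj M (gens limit)).
by rewrite -/incl xE (stage_triv kn Pxy) !linear0.
Qed.

Lemma model_lowdeg n k (x : model k) : k <= n%:Z ->
  lspan (filtration iota model_gen n) x.
Proof.
by move=> kn; apply/model_filtration/lspan_limit_stage/lspan_inclP.
Qed.

Lemma model_minimal n j k (e : j + 1 = k) (x : model k) : j = n.+1%:Z ->
  lspan (filtration iota model_gen n) (dif e x).
Proof.
rewrite difE => jn; have kn : k = n.+2%:Z by lia.
suff : lspan (filtration iota model_gen n) (dpred model k x).
  by case: _ / (deg_pred e).
apply: model_filtration; rewrite model_dpred model_DE.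
exact: stage_minimal kn (lspan_inclP x).
Qed.

(** Freeness is inherited from [M]: a linear retraction [r] of [M] onto the model extends the test
    map [h] to all of sigma, and the resulting morphism on [M] is restricted to the model. *)
Lemma model_relatively_free : relatively_free iota model_gen.
Proof.
split=> [K u h|k x]; last first.
  apply: (model_generated (P := limit)) (lspan_inclP x) => // j.
    by move=> a; left; exists a.
  by move=> xy y Pxy yE; right; exists xy.
pose r k := projT1 (cid (linear_retraction (lspan_subspace (gens limit) k))).
have rK k w : r k (val w) = w :=
  projT2 (cid (linear_retraction (lspan_subspace (gens limit) k))) w.
have lin k : linear (fun xy => h k (r k (ext_sig M k xy))).
  by move=> a x y; rewrite !linearP.
have [psi psiA psiS] := @ext_universal A g M K u (fun k => mklin (lin k)).
exists (glie_comp psi incl) => [k x|k w [xy Pxy wE]].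
  by rewrite -psiA -iotaE.
transitivity (psi k (ext_sig M k xy)); first by rewrite -wE.
by rewrite psiS [LHS]/= -wE; congr (h k _); apply: rK.
Qed.

End Generation.
End Stages.

(** * Assembly of the relative model *)

Lemma relative_model_exists (A g : dglie) (f : dglie_hom A g) :
    simply_connected A -> simply_connected g ->
  exists (L : dglie) (iota : dglie_hom A L) (q : dglie_hom L g)
    (W : forall k, subspace (L k)),
    [/\ relatively_free iota W, simply_connected L,
        forall n k (x : L k), k <= n%:Z -> lspan (filtration iota W n) x,
        forall n j k (e : j + 1 = k) (x : L k), j = n.+1%:Z ->
          lspan (filtration iota W n) (dif e x) &
        quasi_iso q /\ forall k x, q k (iota k x) = f k x].
Proof.
move=> scA scg; have [M] := extension_exists A g.
have [D D_der [D_emb D_sig]] := ext_derivation M.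
have qlin k : linear (fun xy : (M (k - 1) * g k)%type => xy.2) by [].
have [q q_emb q_sig] := @ext_universal A g M g f (fun k => mklin (qlin k)).
have [iota iotaE] := model_iota_exists q D_der D_emb D_sig scA.
have [q' q'E] := model_q_exists D_der D_emb D_sig q_emb q_sig scA.
exists _, iota, q', (model_gen q D_der D_emb D_sig scA); split.
- exact: model_relatively_free.
- exact: model_simply_connected.
- exact: model_lowdeg.
- exact: model_minimal.
- split; first exact: (model_quasi_iso q_sig scg q'E).
  by move=> k x; rewrite q'E iotaE q_emb.
Qed.

Theorem theorem1p3 (V : gspace) (LV : quasi_free V) (g : dglie)
    (f : dglie_hom LV g)
    (scLV : simply_connected LV) (scg : simply_connected g) :
  exists (W : gspace) (LVW : quasi_free (gsum V W))
         (iota : dglie_hom LV LVW) (q : dglie_hom LVW g),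
    [/\ quasi_iso q,
        (* iota is the inclusion of the dg Lie subalgebra L(V) *)
        (forall n, injective (iota n)) /\
        (forall n (v : V n),
           iota n (qf_gen LV n v) = qf_gen LVW n (v, 0%R)),
        (forall n (x : LV n), f n x = q n (iota n x)) &
        forall phi : dglie_hom LVW LVW,
          quasi_iso phi ->
          (exists2 alpha : dglie_hom LV LV,
             dglie_automorphism alpha &
             forall n (x : LV n), phi n (iota n x) = iota n (alpha n x)) ->
          dglie_automorphism phi].
Proof.
have [L [iota [q [W [L_free scL lowdeg minim [qi q_iota]]]]]] :=
  relative_model_exists f scLV scg.
exists (gen_space W), (QuasiFree (rel_gen_free L_free (@qf_free _ LV))), iota,
  q.
split=> //.
- split=> [n|n v]; first exact: relatively_free_inj L_free n.
  exact: esym (addr0 _).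
- exact: rigidity L_free scL lowdeg minim.
Qed.
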